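(* Let $C:f=0$ be an $m$-syzygy curve of degree $d\geq 3$ in $\mathbb{P}^2$ with exponents $1\leq d_1\leq d_2\leq\dots\leq d_m$ and $m\geq 3$. Then $d_1+d_2\geq d$ and $$d_1\leq d_2\leq d_3\leq d-1.$$
   Context: Let $S=\mathbb{C}[x,y,z]$ with its standard grading, and let $C:f=0$ be a reduced curve of degree $d$ in $\mathbb{P}^2$, with $f\in S$ homogeneous of degree $d$. Put $AR(f)=\{(a,b,c)\in S^3: af_x+bf_y+cf_z=0\}$, a graded $S$-module in which $(a,b,c)$ has degree $k$ when $a,b,c\in S_k$. The curve $C$ is an $m$-syzygy curve if a minimal set of homogeneous generators of $AR(f)$ has $m$ elements; the degrees $d_1\leq\dots\leq d_m$ of these generators are the exponents of $C$. *)

(* Defs.v *)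
From mathcomp Require Import all_boot all_order all_algebra.
From mathcomp Require Import complex.
From mathcomp Require Import mpoly.
From mathcomp Require Import reals.

Set Implicit Arguments.
Unset Strict Implicit.
Unset Printing Implicit Defensive.

Import GRing.Theory.
Local Open Scope ring_scope.

(* S = C[x, y, z], where C is R[i] for R a (necessarily unique up to
   isomorphism) complete archimedean ordered field. *)
Notation polyC3 R := {mpoly (R[i])[3]}.

Definition mpdvd (R : realType) (f g : polyC3 R) : Prop :=
  exists h : polyC3 R, g = h * f.

(* The scheme f = 0 is a reduced curve: f is nonzero and the coordinate ring
   S/(f) has no nonzero nilpotent element. *)
Definition reduced_curve (R : realType) (f : polyC3 R) : Prop :=
  f != 0 /\ forall (g : polyC3 R) (n : nat), mpdvd f (g ^+ n) -> mpdvd f g.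

Definition AR (R : realType) (f : polyC3 R) (r : 'rV[polyC3 R]_3) : Prop :=
  \sum_(i < 3) r 0 i * f^`M(i) = 0.

Definition homog_row (R : realType) (k : nat) (r : 'rV[polyC3 R]_3) : Prop :=
  forall i, r 0 i \is k.-homog.

Definition generates_AR (R : realType) (f : polyC3 R) (m : nat)
    (rho : 'I_m -> 'rV[polyC3 R]_3) (J : {set 'I_m}) : Prop :=
  (forall j, j \in J -> AR f (rho j)) /\
  forall r, AR f r ->
    exists c : 'I_m -> polyC3 R, r = \sum_(j in J) c j *: rho j.

(* Minimality is with respect to inclusion. It forces the rho i to be nonzero,
   hence to have at most one degree, and pairwise distinct. *)
Definition minimal_generators (R : realType) (f : polyC3 R) (m : nat)
    (rho : 'I_m -> 'rV[polyC3 R]_3) : Prop :=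
  generates_AR f rho [set: 'I_m] /\
  forall J : {set 'I_m}, generates_AR f rho J -> J = [set: 'I_m].

(* e lists the exponents d_1 <= ... <= d_m, with d_i stored at index i - 1. *)
Definition syzygy_curve (R : realType) (f : polyC3 R) (m : nat)
    (e : m.-tuple nat) : Prop :=
  sorted leq e /\
  exists rho : 'I_m -> 'rV[polyC3 R]_3,
    minimal_generators f rho /\ forall i, homog_row (tnth e i) (rho i).

(* Main.v *)
(* Write [g] for the gradient of [f].  The cross product of two syzygies is
   parallel to [g], and since [f] is reduced it is even a multiple [h *: g]:
   by Euler's relation this amounts to showing that [f] divides [u] whenever it
   divides all [u * g_i], and then [(f : u)] is closed under derivations, hence
   contains a nonzero constant.  If [h] is a unit, the two syzygies generate
   [AR f], which is excluded for [m >= 3].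

   Let [r1], [r2] be the generators of lowest degrees.  They are not parallel: in
   the factorial ring [S], parallel [r1] and [r2] would be multiples of a common
   syzygy, whose degree cannot be less than that of [r1].  As
   [d1 + d2 = deg h + d - 1] and [h] is not constant, [d1 + d2 >= d].  If
   [d3 >= d], then [r1] and [r2] span the Koszul syzygies, which have degree
   [d - 1]; comparing cross products, [h] divides every partial derivative of
   [f], and reducedness makes [h] a unit. *)
Require Import Defs.
From mathcomp Require Import all_boot all_order all_algebra.
From mathcomp Require Import complex.
From mathcomp Require Import mpoly.
From mathcomp Require Import reals.
From mathcomp Require Import boolp ring zify.

Import GRing.Theory Num.Theory.
Local Open Scope ring_scope.

(** * Divisibility and factorial domains *)

Definition rdvd {A : idomainType} (a b : A) : Prop := exists c, b = c * a.

Definition prime_elt {A : idomainType} (p : A) : Prop :=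
  [/\ p != 0, ~ rdvd p 1 &
      forall a b : A, rdvd p (a * b) -> rdvd p a \/ rdvd p b].

(* The norm [N] makes divisor chains finite, so that the existence of prime
   divisors yields factorization into primes. *)
Definition factorial_ring (A : idomainType) : Prop :=
  (exists N : A -> nat, forall a b : A, a * b != 0 ->
     (N b <= N (a * b)%R)%N /\ (~ rdvd a 1 -> (N b < N (a * b)%R)%N)) /\
  (forall a : A, a != 0 -> ~ rdvd a 1 -> exists2 p, prime_elt p & rdvd p a).

Section Divisibility.
Variable A : idomainType.
Implicit Types a b c p : A.

Lemma rdvd_refl a : rdvd a a.
Proof. by exists 1; rewrite mul1r. Qed.

Lemma rdvd_trans a b c : rdvd a b -> rdvd b c -> rdvd a c.
Proof. by move=> [x ->] [y ->]; exists (y * x); rewrite mulrA. Qed.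

Lemma rdvd_mull a b c : rdvd a b -> rdvd a (c * b).
Proof. by move=> [x ->]; exists (c * x); rewrite mulrA. Qed.

Lemma rdvd_mulr a b c : rdvd a b -> rdvd a (b * c).
Proof. by rewrite mulrC; exact: rdvd_mull. Qed.

Lemma rdvdD a b c : rdvd a b -> rdvd a c -> rdvd a (b + c).
Proof. by move=> [x ->] [y ->]; exists (x + y); rewrite mulrDl. Qed.

Lemma rdvd_mul2r c a b : c != 0 -> rdvd (a * c) (b * c) -> rdvd a b.
Proof. by move=> c0 [x]; rewrite mulrA => /(mulIf c0) ->; exists x. Qed.

End Divisibility.

(** Induction on the norm of [c]: a prime [p] dividing [c] stays prime under [i] and its image does
    not divide [f], so it divides [t] and can be cancelled. The map [i] will be the identity or the
    embedding of constants into polynomials. *)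
Lemma rdvd_coprime_mul (A B : idomainType) (i : {rmorphism A -> B}) :
    factorial_ring A -> (forall p, prime_elt p -> prime_elt (i p)) ->
  forall (c : A) (f t : B), c != 0 ->
    (forall p, prime_elt p -> rdvd p c -> ~ rdvd (i p) f) ->
    rdvd (i c) (f * t) -> rdvd (i c) t.
Proof.
move=> [[N Nlt] hp] ip c; have [n] := ubnP (N c).
elim: n c => // n IH c cn f t c0 cf cft.
have [[x cx]|cu] := EM (rdvd c 1).
  by exists (t * i x); rewrite -mulrA -rmorphM -cx rmorph1 mulr1.
have [p pp [c' cE]] := hp _ c0 cu; have [p0 pu _] := pp.
have pc : rdvd p c by exists c'.
have [ip0 _ ipM] := ip _ pp.
have: rdvd (i p) (f * t).
  by apply: rdvd_trans cft; rewrite cE rmorphM; apply: rdvd_mull (rdvd_refl _ _).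
case/ipM => [/(cf _ pp pc)//|[t' tE]].
have c'0 : c' != 0 by apply: contraNneq c0; rewrite cE => ->; rewrite mul0r.
have Nc : (N c' < n)%N.
  rewrite -ltnS; apply: leq_trans cn; rewrite ltnS cE mulrC.
  by apply: (Nlt p c' _).2 => //; rewrite mulf_neq0.
have : rdvd (i c') t'.
  apply: (IH _ Nc f) => // [q pq qc'|].
    by apply: cf => //; rewrite cE; apply: rdvd_mulr.
  by apply: (@rdvd_mul2r _ (i p)) => //; rewrite -rmorphM -cE -mulrA -tE.
by case=> s t'E; exists s; rewrite tE t'E cE rmorphM mulrA.
Qed.

(** Cancelling common primes brings the fraction [a / b] to lowest terms. Coprimality is put in the
    form of Euclid's lemma, in which it is used. *)
Lemma coprime_ratio (A : idomainType) : factorial_ring A ->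
  forall a b : A, b != 0 -> exists g a' b',
    [/\ a = a' * g, b = b' * g & forall t, rdvd b' (a' * t) -> rdvd b' t].
Proof.
move=> FA a b; case: (FA) => [[N Nlt] hp].
have [n] := ubnP (N b); elim: n a b => // n IH a b bn b0.
have [[p [pp [a' aE] [b' bE]]]|ncd] :=
  EM (exists p, [/\ prime_elt p, rdvd p a & rdvd p b]).
  have [p0 pu _] := pp.
  have b'0 : b' != 0 by apply: contraNneq b0; rewrite bE => ->; rewrite mul0r.
  have Nb : (N b' < n)%N.
    rewrite -ltnS; apply: leq_trans bn; rewrite ltnS bE mulrC.
    by apply: (Nlt p b' _).2 => //; rewrite mulf_neq0.
  have [g [a1 [b1 [a1E b1E h]]]] := IH a' b' Nb b'0.
  by exists (g * p), a1, b1; split; rewrite // mulrA -?a1E -?b1E.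
exists 1, a, b; split; rewrite ?mulr1 // => t.
apply: (rdvd_coprime_mul A A idfun) => //= p pp pb pa.
by apply: ncd; exists p.
Qed.

(** * Gauss's lemma and factoriality of polynomial rings *)

Section PolyFactorial.
Variable A : idomainType.
Implicit Types f g h : {poly A}.

Lemma rdvd_polyC (c : A) f : rdvd c%:P f <-> forall i, rdvd c f`_i.
Proof.
split=> [[g ->] i|h]; first by exists g`_i; rewrite coefMC.
exists (\poly_(i < size f) sval (cid (h i))).
apply/polyP=> i; rewrite coefMC coef_poly.
case: ltnP => [_|/(nth_default 0) ->]; last by rewrite mul0r.
by case: cid.
Qed.

Lemma rdvd_polyC1 (c : A) : rdvd c%:P 1 <-> rdvd c 1.
Proof.
split=> [[g] /(congr1 (fun h => h`_0))|[g gE]].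
  by rewrite coefMC coef1 => E; exists g`_0.
by exists g%:P; rewrite -rmorphM -gE.
Qed.

(* Compare the coefficients of lowest index not divisible by [p]. *)
Lemma prime_polyC (p : A) : prime_elt p -> prime_elt p%:P.
Proof.
move=> [p0 pu pM]; split; rewrite ?polyC_eq0 // ?rdvd_polyC1 // => f g pfg.
have H h : rdvd p%:P h \/
   exists i, ~ rdvd p h`_i /\ forall j, (j < i)%N -> rdvd p h`_j.
  have [ph|] := EM (rdvd p%:P h); first by left.
  rewrite rdvd_polyC => /existsNP ex; right.
  have ex' : exists i, ~~ `[< rdvd p h`_i >].
    by case: ex => i hi; exists i; apply/asboolP.
  exists (ex_minn ex'); case: ex_minnP => i /asboolP hi mini; split=> // j ji.
  apply: contrapT => pj; have := mini j.
  by rewrite leqNgt ji => /(_ (introN (asboolP _) pj)).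
have [|[i [hi mi]]] := H f; first by left.
have [|[j [hj mj]]] := H g; first by right.
have ij : (i < (i + j).+1)%N by rewrite ltnS leq_addr.
have /rdvd_polyC/(_ (i + j)%N) := pfg.
(* In the coefficient of index [i + j], every other product has a factor of index below [i] in [f]
   or below [j] in [g], hence is divisible by [p]. *)
rewrite coefM (bigD1 (Ordinal ij)) //= addKn => pS.
have : rdvd p (f`_i * g`_j).
  have -> : f`_i * g`_j = (f`_i * g`_j +
      \sum_(k < (i + j).+1 | k != Ordinal ij) f`_k * g`_(i + j - k)) +
      (-1) * \sum_(k < (i + j).+1 | k != Ordinal ij) f`_k * g`_(i + j - k).
    by rewrite mulN1r addrK.
  apply: rdvdD => //; apply: rdvd_mull.
  elim/big_rec: _ => [|k x kij px]; first by exists 0; rewrite mul0r.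
  apply: rdvdD => //; have [ki|] := ltnP k i; first exact: rdvd_mulr (mi _ ki).
  rewrite leq_eqVlt => /orP[/eqP ik|ik].
    by case/eqP: kij; apply/val_inj.
  by apply: rdvd_mull; apply: mj; have := ltn_ord k; lia.
by case/pM.
Qed.

Hypothesis FA : factorial_ring A.

(** Phrased with primes, so that no gcd of the coefficients has to be chosen. *)
Definition primitive f : Prop := forall p : A, prime_elt p -> ~ rdvd p%:P f.

(** Gauss's lemma: primes of [A] remain prime as constants, and none of them divides [f]. *)
Lemma primitive_dvd (c : A) f g :
  c != 0 -> primitive f -> rdvd c%:P (f * g) -> rdvd c%:P g.
Proof.
move=> c0 pf; apply: (rdvd_coprime_mul _ _ (@polyC A)) => //.
  exact: prime_polyC.
by move=> p pp _; apply: pf.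
Qed.

(** Each prime pulled out of [f] lowers the norm of the leading coefficient, so the process ends. *)
Lemma primitive_part f :
  f != 0 -> exists (c : A) g, [/\ f = g * c%:P & primitive g].
Proof.
case: FA => [[N Nlt] hp].
have [n] := ubnP (N (lead_coef f)); elim: n f => // n IH f fn f0.
have [pf|] := EM (primitive f); first by exists 1, f; rewrite mulr1.
move=> /existsNP[p /not_implyP[pp /contrapT [g fE]]]; have [p0 pu _] := pp.
have g0 : g != 0 by apply: contraNneq f0; rewrite fE => ->; rewrite mul0r.
have Ng : (N (lead_coef g) < n)%N.
  rewrite -ltnS; apply: leq_trans fn; rewrite ltnS fE lead_coefM lead_coefC mulrC.
  by apply: (Nlt p _ _).2 => //; rewrite mulf_neq0 ?lead_coef_eq0.
have [c [h [gE ph]]] := IH _ Ng g0.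
by exists (c * p), h; split; rewrite // rmorphM mulrA -gE.
Qed.

(* The Euclidean algorithm over the fraction field, with denominators cleared. *)
Lemma pseudo_bezout f g : f != 0 -> exists w u v q q' (c c' : A),
  [/\ w != 0, w = u * f + v * g, c != 0 /\ c' != 0,
      c%:P * f = q * w & c'%:P * g = q' * w].
Proof.
(* [w] is a nonzero element of least size in the ideal of [f] and [g]. Pseudo-division of an ideal
   element by [w] leaves a remainder in the ideal, which vanishes by minimality. *)
move=> f0; pose I w := w != 0 /\ exists u v, w = u * f + v * g.
have ex : exists n, `[< exists2 w, I w & size w = n >].
  exists (size f); apply/asboolP; exists f => //; split=> //.
  by exists 1, 0; rewrite mul1r mul0r addr0.
have [n /asboolP[w [w0 [u [v wE]]] wn] minw] := ex_minnP ex.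
have key h : (exists a b, h = a * f + b * g) ->
  exists q (c : A), c != 0 /\ c%:P * h = q * w.
  move=> [a [b hE]].
  exists (h %/ w)%R, (lead_coef w ^+ scalp h w); split.
    by rewrite expf_neq0 // lead_coef_eq0.
  have /= := Pdiv.Idomain.divp_eq h w; rewrite -mul_polyC => E.
  rewrite E; have [->|r0] := eqVneq (h %% w) 0; first by rewrite addr0.
  have := Pdiv.Idomain.ltn_modp h w; rewrite w0 ltnNge wn minw //.
  apply/asboolP; exists (h %% w) => //; split=> //.
  exists ((lead_coef w ^+ scalp h w)%:P * a - (h %/ w) * u).
  exists ((lead_coef w ^+ scalp h w)%:P * b - (h %/ w) * v).
  have -> : h %% w = (lead_coef w ^+ scalp h w)%:P * h - (h %/ w) * w.
    by rewrite E addrC addKr.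
  move: (_%:P) (_ %/ _) => k q; rewrite wE hE; ring.
have [|q [c [c0 cE]]] := key f; first by exists 1, 0; ring.
have [|q' [c' [c'0 c'E]]] := key g; first by exists 0, 1; ring.
by exists w, u, v, q, q', c, c'.
Qed.

(** Let [f] divide [g * h]. The primitive part [w1] of a pseudo-gcd [w] of [f] and [g] divides [f]
    by Gauss's lemma. If the cofactor is a unit, [f] divides [g] along with [w1]. If [w1] is a unit,
    [w] is a constant; [f] divides [w * h], and Gauss's lemma removes the constant. *)
Lemma irreducible_prime f : f != 0 -> (1 < size f)%N -> primitive f ->
    (forall g h, f = g * h -> rdvd g 1 \/ rdvd h 1) ->
  prime_elt f.
Proof.
move=> f0 sf pf irrf; split=> // [|g h [t gh]].
  case=> g gE.
  have /(congr1 (fun p : {poly A} => size p)) := gE.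
  have g0 : g != 0.
    by apply/eqP => g0; have := oner_neq0 {poly A}; rewrite gE g0 mul0r eqxx.
  by rewrite size_poly1 size_mul //; move: g0; rewrite -size_poly_gt0; lia.
have [w [u [v [q [q' [c [c' [w0 wE [c0 c'0] cf cg]]]]]]]] := pseudo_bezout f g f0.
have [e [w1 [w1E pw1]]] := primitive_part w w0.
have : rdvd c%:P (q * e%:P).
  apply: (primitive_dvd c w1) => //.
  by exists f; rewrite [f * _]mulrC cf {1}w1E; ring.
case=> q1 q1E.
have fE : f = q1 * w1.
  apply: (@mulfI _ c%:P); rewrite ?polyC_eq0 // cf w1E.
  transitivity (q * e%:P * w1); first by ring.
  by rewrite q1E; ring.
have [[k kE]|[k kE]] := irrf _ _ fE.
  left; have : rdvd c'%:P (q' * e%:P * k).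
    apply: (primitive_dvd c' f) => //; exists g; rewrite [g * _]mulrC cg w1E fE.
    transitivity (q' * e%:P * w1 * (k * q1)); first by ring.
    by rewrite -kE; ring.
  case=> s sE; exists s; apply: (@mulfI _ c'%:P); rewrite ?polyC_eq0 // cg w1E.
  transitivity (s * c'%:P * f); last by ring.
  rewrite -sE fE; transitivity (q' * e%:P * w1 * (k * q1)); last by ring.
  by rewrite -kE; ring.
right; have sw1 : size w1 == 1%N.
  have : size (k * w1) == 1%N by rewrite -kE size_poly1.
  by rewrite size_mul_eq1 => /andP[].
have /size_poly1P[x x0 xE] := sw1.
have wC : w = (x * e)%:P by rewrite w1E xE -rmorphM.
have : rdvd (x * e)%:P (u * h + v * t).
  apply: (primitive_dvd _ f) => //; first by rewrite -polyC_eq0 -wC.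
  exists h; rewrite -wC wE.
  transitivity (u * f * h + v * (t * f)); first by ring.
  by rewrite -gh; ring.
case=> s sE; exists s; apply: (@mulfI _ w) => //.
rewrite {1}wE; transitivity (u * f * h + v * (g * h)); first by ring.
rewrite gh; transitivity ((u * h + v * t) * f); first by ring.
by rewrite sE -wC; ring.
Qed.

Lemma factorial_poly : factorial_ring {poly A}.
Proof.
case: (FA) => [[N Nlt] hp].
(* A nonunit factor raises the size or, if it is constant, the norm of the leading coefficient. *)
pose M f := (size f + N (lead_coef f))%N.
have Mlt f g : f * g != 0 ->
    (M g <= M (f * g)%R)%N /\ (~ rdvd f 1 -> (M g < M (f * g)%R)%N).
  rewrite mulf_eq0 negb_or => /andP[f0 g0].
  rewrite /M lead_coefM size_mul //.
  have l0 : lead_coef f * lead_coef g != 0 by rewrite mulf_neq0 ?lead_coef_eq0.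
  have sf : (0 < size f)%N by rewrite size_poly_gt0.
  have [] := Nlt _ _ l0; move: (N (_ * _)) (N _) => Nfg Ng Nle Ns.
  split; first by lia.
  have [s1|] := leqP (size f) 1; last by lia.
  have fC := size1_polyC s1.
  move=> fu; suff: ~ rdvd (lead_coef f) 1 by move/Ns; lia.
  by rewrite -rdvd_polyC1 fC lead_coefC -fC.
split; first by exists M.
(* The prime divisor comes from [A] if [f] is constant or not primitive; it is [f] itself if [f] is
   irreducible, and otherwise it is found in a proper factor. *)
move=> f; have [n] := ubnP (M f); elim: n f => // n IH f fn f0 fu.
have [s1|s1] := leqP (size f) 1.
  have fC := size1_polyC s1; move: f0 fu.
  rewrite fC polyC_eq0 rdvd_polyC1 => c0 cu.
  have [p pp [c cE]] := hp _ c0 cu.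
  by exists p%:P; [exact: prime_polyC|exists c%:P; rewrite -rmorphM -cE].
have [pf|] := EM (primitive f); last first.
  move=> /existsNP[p /not_implyP[pp /contrapT pf]].
  by exists p%:P => //; exact: prime_polyC.
have [irr|] := EM (forall g h, f = g * h -> rdvd g 1 \/ rdvd h 1).
  by exists f; [exact: irreducible_prime|exact: rdvd_refl].
move=> /existsNP[g /existsNP[h /not_implyP[fE /not_orP[gu hu]]]].
have gh0 : g * h != 0 by rewrite -fE.
have h0 : h != 0 by apply: contraNneq gh0 => ->; rewrite mulr0.
have [|p pp ph] := IH h _ h0 hu.
  by rewrite -ltnS; apply: leq_trans fn; rewrite ltnS fE; apply: (Mlt _ _ gh0).2.
by exists p => //; rewrite fE; apply: rdvd_mull.
Qed.

End PolyFactorial.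

(** * Factoriality of polynomial rings in several variables over a field *)

Lemma factorial_bij (A B : idomainType) (i : {rmorphism A -> B}) :
  bijective i -> factorial_ring B -> factorial_ring A.
Proof.
move=> [j ij ji] [[N Nlt] hp].
have dv a b : rdvd (i a) (i b) <-> rdvd a b.
  split=> [[c]|[c ->]]; last by exists (i c); rewrite rmorphM.
  by rewrite -(ji c) -rmorphM => /(can_inj ij) ->; exists (j c).
have i0 a : (i a == 0) = (a == 0) by rewrite -(rmorph0 i) (can_eq ij).
split.
  exists (N \o i) => a b; rewrite -i0 rmorphM /= => /Nlt.
  by rewrite -(rmorph1 i) dv rmorphM.
move=> a; rewrite -i0 -dv rmorph1 => a0 au.
have [p [p0 pu pM] pa] := hp _ a0 au.
exists (j p); last by rewrite -dv ji.
split; first by rewrite -i0 ji.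
- by rewrite -dv ji rmorph1.
- by move=> b c; rewrite -!dv ji rmorphM; apply: pM.
Qed.

Lemma factorial_field (A : idomainType) :
  (forall a : A, a != 0 -> rdvd a 1) -> factorial_ring A.
Proof.
move=> u; split; last by move=> a /u.
exists (fun=> 0%N) => a b; split=> // au; exfalso; apply/au/u.
by apply: contraNneq H => ->; rewrite mul0r.
Qed.

Section MpolyFactorial.
Variable K : fieldType.

Lemma muni_monomial n (m : 'X_{1..n.+1}) : muni ('X_[m] : {mpoly K[n.+1]}) =
  'X_[[multinom m (widen_ord (leqnSn n) i) | i < n]] *: 'X^(m ord_max).
Proof. by rewrite muniE msuppX big_seq1 mcoeffX eqxx scale1r. Qed.

Lemma muni_mwiden n (p : {mpoly K[n]}) : muni (mwiden p) = p%:P.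
Proof.
elim/mpolyind: p => [|c m p _ _ IH]; first by rewrite !raddf0.
rewrite !raddfD /= IH mwidenZ muniZ mwidenX muni_monomial mnmwiden_ordmax expr0.
congr (_ + _); rewrite scalerA mul_mpolyC -[RHS]mulr1 mul_polyC.
by congr ((_ *: 'X_[_]) *: _); apply/mnmP => i; rewrite mnmE mnmwiden_widen.
Qed.

Lemma muni_bij n : bijective (@muni n K).
Proof.
(* The inverse substitutes the last variable for the indeterminate; additivity reduces both
   composites to monomials. *)
pose psi (q : {poly {mpoly K[n]}}) := (mpwiden q).['X_ord_max].
have psiD a b : psi (a + b) = psi a + psi b.
  by rewrite /psi (raddfD (@mpwiden n K)) hornerD.
have psi_monomial (c : {mpoly K[n]}) k :
    psi (c *: 'X^k) = mwiden c * 'X_ord_max ^+ k.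
  by rewrite /psi mpwidenZ (rmorphXn (@mpwiden n K)) /= mpwidenX hornerZ hornerXn.
have psi0 : psi 0 = 0 by rewrite /psi (raddf0 (@mpwiden n K)) horner0.
clearbody psi; exists psi => [p|q].
  elim/mpolyind: p => [|c m p _ _ IH].
    by rewrite muni0 psi0.
  rewrite muniD psiD; apply: (f_equal2 +%R _ IH).
  rewrite muniZ muni_monomial scalerA mul_mpolyC psi_monomial.
  rewrite mwidenZ mwidenX -scalerAl; congr (_ *: _).
  rewrite mpolyXn -mpolyXD; congr 'X_[_]; apply/mnmP => i.
  rewrite mnmDE mulmnE mnm1E; case: (unliftP ord_max i) => [j|] ->.
    have -> : lift ord_max j = widen_ord (leqnSn n) j.
      by apply/val_inj; rewrite /= /bump leqNgt ltn_ord.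
    rewrite mnmwiden_widen mnmE; case: eqP => [/(congr1 val)/= E|_].
      by have := ltn_ord j; rewrite -E ltnn.
    by rewrite mul0n addn0.
  by rewrite mnmwiden_ordmax eqxx mul1n.
rewrite -[q]coefK poly_def; elim/big_ind: _ => [|a b IHa IHb|i _].
- by rewrite psi0 muni0.
- by rewrite psiD muniD IHa IHb.
rewrite psi_monomial muniM (rmorphXn (@muni n K)) /= muni_mwiden muni_monomial.
have -> : [multinom U_(ord_max)%MM (widen_ord (leqnSn n) j) | j < n] = 0%MM.
  apply/mnmP => j; rewrite mnmE mnm0E mnm1E; case: eqP => // /(congr1 val) /= E.
  by have := ltn_ord j; rewrite -E ltnn.
by rewrite mnm1E eqxx mpolyX0 scale1r mul_polyC.
Qed.

Lemma factorial_mpoly n : factorial_ring {mpoly K[n]}.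
Proof.
elim: n => [|n IH].
  apply: factorial_field => a; rewrite (nvar0_mpolyC a) mpolyC_eq0 => a0.
  by exists ((a@_0)^-1)%:MP; rewrite -mpolyCM mulVf.
exact: (factorial_bij _ _ (@muni n K) (muni_bij n) (factorial_poly _ IH)).
Qed.

End MpolyFactorial.

(** * Cross product identities in rank three *)

Section CrossProduct.
Variable S : comNzRingType.
Implicit Types u v w g : 'rV[S]_3.

Let o0 : 'I_3 := @Ordinal 3 0 isT.
Let o1 : 'I_3 := @Ordinal 3 1 isT.
Let o2 : 'I_3 := @Ordinal 3 2 isT.

Definition dot u v : S := \sum_(i < 3) u 0 i * v 0 i.

Definition cross u v : 'rV[S]_3 :=
  \row_(i < 3) [:: u 0 o1 * v 0 o2 - u 0 o2 * v 0 o1;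
                   u 0 o2 * v 0 o0 - u 0 o0 * v 0 o2;
                   u 0 o0 * v 0 o1 - u 0 o1 * v 0 o0]`_i.

Lemma ord3P (P : 'I_3 -> Prop) : P o0 -> P o1 -> P o2 -> forall i, P i.
Proof.
move=> P0 P1 P2 [[|[|[|//]]] lti].
- by have -> : Ordinal lti = o0 by exact: val_inj.
- by have -> : Ordinal lti = o1 by exact: val_inj.
- by have -> : Ordinal lti = o2 by exact: val_inj.
Qed.

Lemma dotE u v : dot u v = u 0 o0 * v 0 o0 + u 0 o1 * v 0 o1 + u 0 o2 * v 0 o2.
Proof.
rewrite /dot !big_ord_recl big_ord0 addr0 addrA.
have -> : lift ord0 ord0 = o1 by exact: val_inj.
have -> : lift ord0 (lift ord0 ord0) = o2 by exact: val_inj.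
by have -> : ord0 = o0 by exact: val_inj.
Qed.

Lemma dotC u v : dot u v = dot v u.
Proof. by apply: eq_bigr => i _; rewrite mulrC. Qed.

Lemma dotZl a u v : dot (a *: u) v = a * dot u v.
Proof. by rewrite /dot mulr_sumr; apply: eq_bigr => i _; rewrite mxE mulrA. Qed.

(** Lagrange's triple product expansion. *)
Lemma cross_cross u v w : cross u (cross v w) = dot u w *: v - dot u v *: w.
Proof. by apply/rowP; apply: ord3P; rewrite !mxE /= ?mxE /= !dotE; ring. Qed.

Lemma crossC u v : cross u v = - cross v u.
Proof. by apply/rowP; apply: ord3P; rewrite !mxE /= ?mxE /=; ring. Qed.

Lemma cross_self u : cross u u = 0.
Proof. by apply/rowP; apply: ord3P; rewrite !mxE /=; ring. Qed.

Lemma crossDl u v w : cross (u + v) w = cross u w + cross v w.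
Proof. by apply/rowP; apply: ord3P; rewrite !mxE /= ?mxE; ring. Qed.

Lemma crossZl a u v : cross (a *: u) v = a *: cross u v.
Proof. by apply/rowP; apply: ord3P; rewrite !mxE /= ?mxE; ring. Qed.

Lemma cross_comb a b a' b' u v :
  cross (a *: u + b *: v) (a' *: u + b' *: v) = (a * b' - a' * b) *: cross u v.
Proof. by apply/rowP; apply: ord3P; rewrite !mxE /= ?mxE; ring. Qed.

Lemma dot_cross_self u v : dot (cross u v) v = 0.
Proof. by rewrite dotE !mxE /=; ring. Qed.

(** For unit vectors [u], [v] and the gradient [g], this makes a partial derivative appear in the
    cross product of two Koszul syzygies. *)
Lemma cross_cross_common u v g :
  cross (cross u g) (cross v g) = dot (cross u v) g *: g.
Proof.
by apply/rowP; apply: ord3P; rewrite !mxE /= ?mxE /= !dotE !mxE /=; ring.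
Qed.

(* The rule [adj M *m M = \det M *: 1], for [M] with rows [u], [v] and [w]. *)
Lemma cross_adjugate u v w i j :
  u 0 i * cross v w 0 j + v 0 i * cross w u 0 j + w 0 i * cross u v 0 j =
  dot (cross u v) w *+ (i == j).
Proof. by move: i j; apply: ord3P; apply: ord3P; rewrite !dotE !mxE /=; ring. Qed.

Lemma delta_cross k : exists a b : 'I_3,
  cross (delta_mx 0 a) (delta_mx 0 b) = delta_mx 0 k.
Proof.
move: k; apply: ord3P; [exists o1, o2|exists o2, o0|exists o0, o1];
  by apply/rowP; apply: ord3P; rewrite !mxE /= ?mxE /=; ring.
Qed.

Lemma dot_delta k v : dot (delta_mx 0 k) v = v 0 k.
Proof.
rewrite /dot (bigD1 k) //= big1 ?addr0 ?mxE ?eqxx ?mul1r // => i /negPf ik.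
by rewrite mxE ik andbF mul0r.
Qed.

Lemma cross0_eq u v i j : cross u v = 0 -> u 0 i * v 0 j = u 0 j * v 0 i.
Proof.
move=> uv; have E k : cross u v 0 k = 0 by rewrite uv mxE.
move: (E o0) (E o1) (E o2); rewrite !mxE /= => E0 E1 E2.
by move: i j; apply: ord3P; apply: ord3P => //;
  apply/eqP; rewrite -subr_eq0; apply/eqP;
  first [exact: E0|exact: E1|exact: E2
        |rewrite -[RHS]oppr0 -E0; ring|rewrite -[RHS]oppr0 -E1; ring
        |rewrite -[RHS]oppr0 -E2; ring].
Qed.

End CrossProduct.

Arguments dot {S}.
Arguments cross {S}.

(** * Parallel and independent vectors over a domain *)

Section CrossDomain.
Variable S : idomainType.
Implicit Types u v w g : 'rV[S]_3.

(** In the adjugate identity only the product of [u 0 i] with a nonzero component of [cross v w]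
    survives. *)
Lemma cross_eq0_indep u v w :
  cross v w != 0 -> cross u v = 0 -> cross u w = 0 -> u = 0.
Proof.
move=> /rV0Pn[j vwj] uv uw; apply/rowP=> i; rewrite mxE.
have := cross_adjugate _ u v w i j.
have z k : (0 : 'rV[S]_3) 0 k = 0 by rewrite mxE.
rewrite uv (crossC _ w u) uw oppr0 dotE !z !mulr0 !mul0r !addr0 mul0rn.
by move/eqP; rewrite mulf_eq0 (negPf vwj) orbF => /eqP.
Qed.

(** Cramer's rule: the difference of the two sides is parallel to both [u] and [v], which are
    independent. *)
Lemma cross_coordinates u v t g h k h1 h2 :
    cross u v = h *: g -> k * h = 1 -> g != 0 ->
    cross t u = h1 *: g -> cross t v = h2 *: g ->
  t = (k * h2) *: u + (- (k * h1)) *: v.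
Proof.
move=> uv kh g0 tu tv; apply/eqP; rewrite -subr_eq0; apply/eqP.
have uv0 : cross u v != 0.
  have /rV0Pn[i gi] := g0; apply/rV0Pn; exists i; rewrite uv mxE mulf_neq0 //.
  by apply/eqP => h0; have := oner_neq0 S; rewrite -kh h0 mulr0 eqxx.
have vu : cross v u = - h *: g by rewrite crossC uv scaleNr.
rewrite opprD -!scaleNr opprK.
apply: (cross_eq0_indep _ _ _ uv0); rewrite !crossDl !crossZl !cross_self.
  rewrite tu vu scaler0 add0r scalerA -scalerDl.
  have -> : h1 + k * h1 * - h = h1 * (1 - k * h) by ring.
  by rewrite kh subrr mulr0 scale0r.
rewrite tv uv scaler0 addr0 scalerA -scalerDl.
have -> : h2 + - (k * h2) * h = h2 * (1 - k * h) by ring.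
by rewrite kh subrr mulr0 scale0r.
Qed.

Lemma rdvd_row a u : (forall i, rdvd a (u 0 i)) -> exists v, u = a *: v.
Proof.
move=> h; exists (\row_i sval (cid (h i))); apply/rowP=> i; rewrite !mxE.
by case: cid => /= c ->; rewrite mulrC.
Qed.

(** Write [v 0 k / u 0 k] as [b / a] in lowest terms. Then [a * v 0 i = b * u 0 i] for all [i], so
    [a] divides every component of [u], and [w] is the quotient. *)
Lemma parallel_factor u v : factorial_ring S -> u != 0 -> cross u v = 0 ->
  exists a b w, u = a *: w /\ v = b *: w.
Proof.
move=> FS /rV0Pn[k uk] uv.
have [g [b [a [vE uE h]]]] := coprime_ratio _ FS (v 0 k) (u 0 k) uk.
have [g0 a0] : g != 0 /\ a != 0.
  by split; apply: contraNneq uk => E; rewrite uE E ?mulr0 ?mul0r.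
have E i : a * v 0 i = b * u 0 i.
  apply: (mulIf g0); rewrite mulrAC -uE mulrAC -vE [RHS]mulrC.
  exact: cross0_eq uv.
have [w wE] : exists w, u = a *: w.
  by apply: rdvd_row => i; apply: h; exists (v 0 i); rewrite -E mulrC.
exists a, b, w; split=> //; apply/rowP=> i; apply: (mulfI a0).
by rewrite E wE !mxE; ring.
Qed.

Lemma multiple_of_unit_multiple u v w a b k :
  u = a *: w -> v = b *: w -> k * a = 1 -> v = (b * k) *: u.
Proof. by move=> -> -> ka; rewrite scalerA -mulrA ka mulr1. Qed.

End CrossDomain.

(** * Homogeneous components and derivatives of polynomials *)

Section MpolyHomog.
Variables (n : nat) (K : numFieldType).
Implicit Types p q f u g : {mpoly K[n]}.

Lemma euler d p : p \is d.-homog ->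
  \sum_(i < n) 'X_i * p^`M(i) = d%:R *: p.
Proof.
move=> /dhomogP hp; rewrite [in RHS](mpolyE p) scaler_sumr.
under eq_bigr do rewrite /mderiv mulr_sumr.
rewrite exchange_big /= !big_seq; apply: eq_bigr => m mp.
have <- : mdeg m = d := hp m mp.
rewrite scalerA mdegE natr_sum mulr_suml scaler_suml.
apply: eq_bigr => i _; rewrite -scalerAr -mpolyXD.
case: (posnP (m i)) => [->|mi]; first by rewrite !mul0r !scale0r.
congr (_ *: 'X_[_]); rewrite addmC submK //.
by rewrite lep1mP -lt0n.
Qed.

Lemma mderiv_homog d p i : p \is d.-homog -> p^`M(i) \is d.-1.-homog.
Proof.
move=> hp; apply/dhomogP=> m; rewrite mcoeff_msupp mcoeff_deriv => E.
have : (m + U_(i))%MM \in msupp p.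
  by rewrite mcoeff_msupp; apply: contraNneq E => ->; rewrite mul0rn.
move/(dhomog_mf hp) => mE; have <- : mdeg (m + U_(i)) = d := mE.
by rewrite mdegD mdeg1 addn1.
Qed.

Lemma msize_homog d p : p != 0 -> p \is d.-homog -> msize p = d.+1.
Proof.
by move=> p0 /dhomog_mf/(_ _ (mlead_supp p0)) /= <-; rewrite -mlead_deg.
Qed.

Lemma msize1_unit p : p != 0 -> (msize p <= 1)%N -> exists q, q * p = 1.
Proof.
move=> p0 p1; move: p0; rewrite (msize1_polyC p1) mpolyC_eq0 => c0.
by exists (p@_0)^-1%:MP; rewrite -mpolyCM mulVf.
Qed.

Lemma mcoeff_mul_low k p q m : p \is k.-homog -> (mdeg m < k)%N -> (q * p)@_m = 0.
Proof.
move=> hp mk; rewrite mcoeffM big1 // => -[a b] /= /eqP mE.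
rewrite (dhomog_nemf_coeff hp) ?mulr0 //; apply: contraTneq mk => <-.
rewrite -leqNgt; have /(congr1 mdeg) := mE.
by rewrite mdegD => mD; apply: leq_trans (leq_addl _ _) (eq_leq (esym mD)).
Qed.

(** The case distinction guards against truncated subtraction: for [k > d], [d - k] is 0 and would
    select the constant term of [q]. *)
Lemma pihomog_mul k d p q : p \is k.-homog ->
  pihomog mdeg d (q * p) = (if (k <= d)%N then pihomog mdeg (d - k) q else 0) * p.
Proof.
move=> hp; elim/mpolyind: q => [|c m q _ _ IH].
  by rewrite mul0r !pihomog0; case: ifP; rewrite mul0r.
rewrite mulrDl pihomogD {}IH -scalerAl linearZ /=.
have h : 'X_[m] * p \is (mdeg m + k).-homog by rewrite dhomogM // dhomogX.
have -> : pihomog mdeg d ('X_[m] * p) =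
    (if mdeg m + k == d then 'X_[m] * p else 0).
  case: eqP => [<-|/eqP ne]; first exact: pihomog_dE.
  exact: pihomog_ne0 ne h.
case: leqP => kd; last first.
  by rewrite !mul0r addr0 gtn_eqF ?scaler0 // (leq_trans kd) ?leq_addl.
rewrite pihomogD linearZ /= pihomogX mulrDl -scalerAl.
rewrite -(eqn_add2r k _ (d - k)) subnK //.
by case: eqP; rewrite ?mul0r.
Qed.

Lemma homog_comb (I : finType) (q x : I -> {mpoly K[n]}) (e : I -> nat) d p :
    (forall l, x l \is (e l).-homog) -> p \is d.-homog ->
    p = \sum_l q l * x l ->
  p = \sum_l (if (e l <= d)%N then pihomog mdeg (d - e l) (q l) else 0) * x l.
Proof.
move=> hx hp pE; rewrite -{1}(pihomog_dE hp) pE raddf_sum /=.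
by apply: eq_bigr => l _; apply: pihomog_mul.
Qed.

Lemma mderiv_msize g i : (1 < msize g)%N -> (msize g^`M(i) < msize g)%N.
Proof.
move=> g1; have [->|g0] := eqVneq g^`M(i) 0; first by rewrite msize0; lia.
have : (mlead g^`M(i) + U_(i))%MM \in msupp g.
  have := mlead_supp g0; rewrite !mcoeff_msupp mcoeff_deriv.
  by apply: contraNneq => ->; rewrite mul0rn.
by move/msize_mdeg_lt; rewrite mdegD mdeg1 addn1 -(mlead_deg g0).
Qed.

(** In characteristic zero, the leading monomial survives differentiation by a variable occurring in
    it. *)
Lemma mderiv_neq0 g : (1 < msize g)%N -> exists i, g^`M(i) != 0.
Proof.
move=> g1; have g0 : g != 0 by apply: contraTneq g1 => ->; rewrite msize0.
have [i mi] : exists i, mlead g i != 0%N.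
  apply/existsP; apply: contraTT g1 => /existsPn H.
  rewrite -mlead_deg // ltnS -leqNgt leqn0 mdeg_eq0; apply/eqP/mnmP=> i.
  by rewrite mnm0E; apply/eqP; rewrite -[_ == _]negbK H.
exists i; apply/eqP => /(congr1 (mcoeff (mlead g - U_(i))%MM)).
rewrite mcoeff0 mcoeff_deriv submK; last by rewrite lep1mP.
by apply/eqP; rewrite mulrn_eq0 /= mleadc_eq0.
Qed.

(* [(f : u)] equals [(f : u ^+ 2)] because [f] is reduced, hence is closed under
   derivations; differentiating [f] often enough yields a nonzero constant in
   it. *)
Lemma reduced_dvd_of_mderiv f u : f != 0 ->
    (forall g k, rdvd f (g ^+ k) -> rdvd f g) ->
    (forall i, rdvd f (u * f^`M(i))) -> rdvd f u.
Proof.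
move=> f0 red fu.
(* Differentiating [g * u = h * f] and multiplying by [u] gives a multiple of [f], by the hypothesis
   on [u]. Hence [f] divides [g^]M(i) * u * u[, and so the square of]g^[M(i) * u]. *)
have fI i g : rdvd f (g * u) -> rdvd f (g^`M(i) * u).
  move=> fgu; apply: (red _ 2); have [h hE] := fgu.
  have : rdvd f ((g * u)^`M(i) * u).
    rewrite hE mderivM mulrDl; apply: rdvdD.
      by exists (h^`M(i) * u); ring.
    by rewrite -mulrA [_ * u]mulrC; apply: rdvd_mull.
  rewrite mderivM mulrDl => E.
  have : rdvd f (g^`M(i) * u * u).
    have -> : g^`M(i) * u * u = (g^`M(i) * u * u + g * u^`M(i) * u) +
       (- u^`M(i)) * (g * u) by ring.
    by apply: rdvdD E (rdvd_mull _ _ _ _ fgu).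
  move=> E'; rewrite expr2; have -> : g^`M(i) * u * (g^`M(i) * u) =
    g^`M(i) * (g^`M(i) * u * u) by ring.
  exact: rdvd_mull.
(* The descent on the size of [g] starts from [f] itself. *)
suff H g : g != 0 -> rdvd f (g * u) -> rdvd f u.
  by apply: (H f) => //; apply/rdvd_mulr/rdvd_refl.
have [k] := ubnP (msize g); elim: k g => // k IH g gk g0 fgu.
have [g1|g1] := leqP (msize g) 1; last first.
  have [i gi] := mderiv_neq0 _ g1.
  by apply: (IH g^`M(i)) => //; [have := mderiv_msize _ i g1; lia|exact: fI].
move: fgu g0; rewrite (msize1_polyC g1) mpolyC_eq0 => -[h hE] c0.
exists ((g@_0)^-1 *: h); rewrite -scalerAl -hE mul_mpolyC scalerA mulVf //.
by rewrite scale1r.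
Qed.

End MpolyHomog.

(** * Syzygies of the gradient of a reduced form *)

Section Syzygies.
Variables (R : realType) (d : nat) (f : polyC3 R).
Hypotheses (d_gt0 : (0 < d)%N) (hf : f \is d.-homog) (hred : reduced_curve f).
Implicit Types (r s : 'rV[polyC3 R]_3) (h u : polyC3 R).

Definition grad : 'rV[polyC3 R]_3 := \row_i f^`M(i).

Lemma AR_dot r : AR f r <-> dot r grad = 0.
Proof.
rewrite /AR /dot; suff -> : \sum_(i < 3) r 0 i * grad 0 i =
  \sum_(i < 3) r 0 i * f^`M(i) by [].
by apply: eq_bigr => i _; rewrite mxE.
Qed.

Lemma natC_neq0 : (d%:R : R[i]) != 0.
Proof. by rewrite pnatr_eq0 -lt0n. Qed.

Lemma dot_euler : dot (\row_i 'X_i) grad = d%:R *: f.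
Proof.
by rewrite -(euler _ _ d f hf); apply: eq_bigr => i _; rewrite !mxE.
Qed.

Lemma grad_homog i : grad 0 i \is d.-1.-homog.
Proof. by rewrite mxE; apply: mderiv_homog. Qed.

Lemma grad_neq0 : grad != 0.
Proof.
have [f0 _] := hred; apply: contraNneq f0 => g0.
have := dot_euler; rewrite g0 dotE !mxE !mulr0 !addr0 => /esym/eqP.
by rewrite mscalerI (negPf natC_neq0) => /eqP ->.
Qed.

Lemma reduced_dvd u : (forall i, rdvd f (u * grad 0 i)) -> rdvd f u.
Proof.
have [f0 fr] := hred => fu; apply: reduced_dvd_of_mderiv => // i.
by have := fu i; rewrite mxE.
Qed.

Lemma cross_syzygies r s : AR f r -> AR f s -> exists h, cross r s = h *: grad.
Proof.
rewrite !AR_dot => rg sg; set w := cross r s.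
pose e : 'rV[polyC3 R]_3 := \row_i 'X_i.
have wg : cross w grad = 0.
  rewrite crossC cross_cross (dotC _ _ s) (dotC _ _ r) rg sg.
  by rewrite !scale0r subr0 oppr0.
(* Expand the triple product of the position vector [e] with [w] and the gradient, and use Euler's
   relation. *)
have E : (d%:R *: f) *: w = dot e w *: grad.
  have := cross_cross _ e w grad; rewrite wg dot_euler => /esym/eqP.
  suff -> : cross e 0 = 0 by rewrite subr_eq0 => /eqP.
  by rewrite crossC -(scale0r 0) crossZl !scale0r oppr0.
have Ei i : d%:R *: (f * w 0 i) = dot e w * grad 0 i.
  by move/rowP/(_ i): E; rewrite [LHS]mxE [RHS]mxE -scalerAl.
have [h hE] : rdvd f (dot e w).
  by apply: reduced_dvd => i; exists (d%:R *: w 0 i); rewrite -Ei -scalerAl mulrC.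
exists ((d%:R)^-1 *: h); have [f0 _] := hred.
apply/rowP=> i; apply: (mulfI f0).
apply: (scalerI natC_neq0); rewrite Ei hE [in RHS]mxE -scalerAl -scalerAr.
by rewrite scalerA mulfV ?natC_neq0 // scale1r; ring.
Qed.

Lemma syzygy_basis r s h k : AR f r -> AR f s -> cross r s = h *: grad ->
  k * h = 1 -> forall t, AR f t -> exists a b, t = a *: r + b *: s.
Proof.
move=> hr hs rs kh t ht.
have [h1 tr] := cross_syzygies _ _ ht hr.
have [h2 ts] := cross_syzygies _ _ ht hs.
exists (k * h2), (- (k * h1)).
exact: cross_coordinates rs kh grad_neq0 tr ts.
Qed.

(** These are the Koszul syzygies; for [k = 0] the row is [(0, -f_z, f_y)]. *)
Lemma koszul_AR k : AR f (cross (delta_mx 0 k) grad).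
Proof. by rewrite AR_dot dot_cross_self. Qed.

Lemma koszul_homog k : homog_row d.-1 (cross (delta_mx 0 k) grad).
Proof.
have D i j : (delta_mx 0 k : 'rV[polyC3 R]_3) 0 i * grad 0 j \is d.-1.-homog.
  rewrite mxE; case: (_ && _); rewrite ?mul1r ?mul0r ?grad_homog //.
  exact: dhomog0.
by apply: ord3P; rewrite mxE /=; apply: rpredB; apply: D.
Qed.

(* If [r] and [s] span the Koszul syzygies, the coefficient of [cross r s] divides
   every partial derivative, so its cofactor in Euler's relation is a multiple
   of [f]. *)
Lemma koszul_span_unit r s h : cross r s = h *: grad ->
    (forall k, exists a b, cross (delta_mx 0 k) grad = a *: r + b *: s) ->
  exists k, k * h = 1.
Proof.
move=> rs span; have /rV0Pn[j gj] := grad_neq0.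
have dv k : rdvd h (grad 0 k).
  have [a [b ab]] := delta_cross (polyC3 R) k.
  have [x [y xy]] := span a; have [x' [y' xy']] := span b.
  exists (x * y' - x' * y).
  (* The cross product of the Koszul syzygies of indices [a] and [b] is computed twice: from the
     gradient and from [r], [s]. *)
  have := cross_cross_common _ (delta_mx 0 a) (delta_mx 0 b) grad.
  rewrite ab dot_delta xy xy' cross_comb rs scalerA => /rowP/(_ j).
  by rewrite [LHS]mxE [RHS]mxE => /(mulIf gj).
have [g gE] := rdvd_row _ _ _ dv.
pose v := dot g (\row_i 'X_i).
have vE : v * h = d%:R *: f by rewrite -dot_euler [RHS]dotC gE dotZl mulrC.
have [f0 _] := hred.
(* Since the gradient is [h *: g], [v] times a partial derivative is [v * h = d%:R *: f] times a
   component of [g]. *)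
have [t tE] : rdvd f v.
  apply: reduced_dvd => i; exists (d%:R *: g 0 i).
  by rewrite gE mxE -scalerAl [g 0 i * f]mulrC scalerAl -vE; ring.
exists ((d%:R)^-1 *: t); apply: (mulIf f0); rewrite mul1r.
rewrite -!scalerAl mulrAC -tE vE scalerA mulVf ?scale1r //.
exact: natC_neq0.
Qed.

End Syzygies.

(** * Rearranging linear combinations of a finite family *)

Section LinearCombinations.
Variables (S : nzRingType) (V : lmodType S) (m : nat) (rho : 'I_m -> V).

Lemma comb_without_multiple (a : 'I_m -> S) c i j :
    i != j -> rho i = c *: rho j ->
  exists b, \sum_k a k *: rho k = \sum_(k in [set~ i]) b k *: rho k.
Proof.
move=> ij rij; exists (fun k => a k + (if k == j then a i * c else 0)).
rewrite (bigD1 i) //= rij scalerA.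
under [RHS]eq_bigr do rewrite scalerDl.
rewrite big_split /= [RHS]addrC; congr (_ + _); last first.
  by apply: eq_bigl => k; rewrite !inE.
rewrite (bigD1 j) ?inE 1?eq_sym //= eqxx big1 ?addr0 // => k /andP[_ /negPf ->].
by rewrite scale0r.
Qed.

Lemma comb_two (a b : S) i j :
  exists c, a *: rho i + b *: rho j = \sum_(k in [set i; j]) c k *: rho k.
Proof.
have [->|ij] := eqVneq i j.
  by exists (fun=> a + b); rewrite setUid big_set1 scalerDl.
exists (fun k => if k == i then a else b).
by rewrite big_setU1 ?inE //= big_set1 eqxx eq_sym (negPf ij).
Qed.

Lemma comb_supported_two (a : 'I_m -> S) i j : i != j ->
    (forall k, k != i -> k != j -> a k = 0) ->
  \sum_k a k *: rho k = a i *: rho i + a j *: rho j.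
Proof.
move=> ij a0; rewrite (bigD1 i) //= (bigD1 j) 1?eq_sym //= big1 ?addr0 //.
move=> k /andP[ki kj].
by rewrite a0 ?scale0r.
Qed.

End LinearCombinations.

(** * Degrees of minimal generators *)

Section MinimalGenerators.
Variables (R : realType) (d : nat) (f : polyC3 R) (m : nat).
Variable (rho : 'I_m -> 'rV[polyC3 R]_3).
Hypotheses (d_gt0 : (0 < d)%N) (hf : f \is d.-homog) (hred : reduced_curve f).
Hypothesis hmin : minimal_generators f rho.

Lemma generator_AR i : AR f (rho i).
Proof. by have [[+ _] _] := hmin; apply; rewrite inE. Qed.

Lemma syzygy_comb r : AR f r -> exists c, r = \sum_i c i *: rho i.
Proof.
have [[_ H] _] := hmin => /H[c ->]; exists c.
by apply: eq_bigl => i; rewrite inE.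
Qed.

(** Such a generator could be dropped. The case [c = 0] will show that generators are nonzero. *)
Lemma generator_not_multiple i j c : i != j -> rho i <> c *: rho j.
Proof.
move=> ij rij; have [_ /(_ [set~ i])] := hmin.
suff H : generates_AR f rho [set~ i].
  by move=> /(_ H)/setP/(_ i); rewrite !inE eqxx.
split=> [k _|r /syzygy_comb[a ->]]; first exact: generator_AR.
exact: comb_without_multiple ij rij.
Qed.

Lemma generators_not_two i j : (3 <= m)%N ->
  ~ (forall r, AR f r -> exists a b, r = a *: rho i + b *: rho j).
Proof.
move=> m3 span; have [_ /(_ [set i; j])] := hmin.
suff H : generates_AR f rho [set i; j].
  move=> /(_ H)/(congr1 (fun A : {set 'I_m} => #|A|)).
  by rewrite cards2 cardsT card_ord; lia.
split=> [k _|r /span[a [b ->]]]; first exact: generator_AR.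
exact: comb_two.
Qed.

Lemma cross_generators_not_unit i j h k : (3 <= m)%N ->
  cross (rho i) (rho j) = h *: grad R f -> k * h <> 1.
Proof.
move=> m3 hE kh; apply: (generators_not_two i j m3).
exact: (syzygy_basis _ _ _ d_gt0 hf hred _ _ _ _
         (generator_AR i) (generator_AR j) hE kh).
Qed.

Variable e : 'I_m -> nat.
Hypothesis he : forall i, homog_row (e i) (rho i).

Lemma cross_generators_neq0 i j : i != j -> (forall k, e i <= e k)%N ->
  cross (rho i) (rho j) != 0.
Proof.
move=> ij emin; apply/eqP => rij.
have ri0 : rho i != 0.
  by apply/eqP => E; apply: (generator_not_multiple i j 0 ij); rewrite scale0r.
have [a [b [w [iE jE]]]] :=
  parallel_factor _ _ _ (factorial_mpoly R[i] 3) ri0 rij.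
have a0 : a != 0 by apply: contraNneq ri0 => E; rewrite iE E scale0r.
have ARw : AR f w.
  apply/AR_dot; have /AR_dot := generator_AR i; rewrite iE.
  by rewrite dotZl => /eqP; rewrite mulf_eq0 (negPf a0) => /eqP.
have [c wE] := syzygy_comb _ ARw.
have /rV0Pn[k rk] := ri0.
have wk : w 0 k != 0 by apply: contraNneq rk => E; rewrite iE mxE E mulr0.
(* All generators have degree at least [e i], so no combination of them has a term of lower
   degree. *)
have wlow : (e i < msize (w 0%R k))%N.
  rewrite ltnNge; apply: contra wk => small.
  apply/eqP/mpolyP => n; rewrite mcoeff0.
  have [|/msize_mdeg_ge/memN_msupp_eq0//] := ltnP (mdeg n) (msize (w 0 k)).
  move=> nw; rewrite wE summxE raddf_sum big1 // => l _ /=; rewrite mxE.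
  apply: mcoeff_mul_low (he l k) _; apply: leq_trans (emin l).
  exact: leq_trans small.
(* As [msize] is the degree plus one, the sizes of [a] and [w 0 k] add up to [e i + 2]; hence [a] is
   constant. *)
have := msize_homog _ _ _ _ rk (he i k).
rewrite iE mxE msizeM // => sa.
have {sa} : (msize a + msize (w 0%R k)).-1 = (e i).+1 := sa.
move: wlow; move: (msize (w 0 k)) => sw swi sa.
have a1 : (msize a <= 1)%N by move: (msize a) sa => sa; lia.
have [k1 k1a] := msize1_unit _ _ a a0 a1.
apply: (generator_not_multiple j i (b * k1)); first by rewrite eq_sym.
exact: multiple_of_unit_multiple iE jE k1a.
Qed.

Lemma min_exponents_sum i j : (3 <= m)%N -> i != j -> (forall k, e i <= e k)%N ->
  (d <= e i + e j)%N.
Proof.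
move=> m3 ij emin; rewrite leqNgt; apply/negP => small.
have [h hE] :=
  cross_syzygies _ _ _ d_gt0 hf hred _ _ (generator_AR i) (generator_AR j).
have c0 := cross_generators_neq0 _ _ ij emin.
have /rV0Pn[k ck] := c0.
have hom : cross (rho i) (rho j) 0 k \is (e i + e j).-homog.
  move: k {ck}; apply: ord3P; rewrite mxE /=; apply: rpredB;
    by [apply: dhomogM; exact: he | rewrite addnC; apply: dhomogM; exact: he].
have s1 := msize_homog _ _ _ _ ck hom.
move: ck; rewrite hE mxE mulf_eq0 negb_or => /andP[h0 gk].
(* Comparing sizes gives [msize h + d = e i + e j + 2], so a sum of exponents below [d] forces [h]
   to be constant. *)
move: s1; rewrite hE mxE msizeM //.
rewrite (msize_homog _ _ _ _ gk (grad_homog _ _ _ hf k)) => s1.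
have h1 : (msize h <= 1)%N by move: (msize h) s1 small => sh; lia.
have [k1 k1h] := msize1_unit _ _ h h0 h1.
exact: (cross_generators_not_unit _ _ _ _ m3 hE k1h).
Qed.

(** The coefficients may be replaced by their components of degree [k - e l], which leaves nothing
    on generators of degree above [k]. *)
Lemma low_syzygy_span i j k r : homog_row k r -> AR f r -> i != j ->
    (forall l, l != i -> l != j -> (k < e l)%N) ->
  exists a b, r = a *: rho i + b *: rho j.
Proof.
move=> hr /syzygy_comb[c rE] ij big.
pose q l := if (e l <= k)%N then pihomog mdeg (k - e l) (c l) else 0.
have q0 l : l != i -> l != j -> q l = 0.
  by move=> li lj; rewrite /q leqNgt big.
exists (q i), (q j); apply: etrans (comb_supported_two _ _ _ rho q i j ij q0).
apply/rowP => n; have rn : r 0 n = \sum_l c l * rho l 0 n.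
  by rewrite rE summxE; apply: eq_bigr => l _; rewrite [LHS]mxE.
have he_n l : rho l 0 n \is (e l).-homog := he l n.
rewrite summxE (homog_comb _ _ _ _ _ _ _ _ he_n (hr n) rn).
by apply: eq_bigr => l _; rewrite [RHS]mxE.
Qed.

Lemma third_exponent_bound i j : (3 <= m)%N -> i != j ->
  exists l, [/\ l != i, l != j & (e l <= d.-1)%N].
Proof.
move=> m3 ij; apply: contrapT => H.
have big l : l != i -> l != j -> (d.-1 < e l)%N.
  by move=> li lj; rewrite ltnNge; apply/negP => el; apply: H; exists l.
have [h hE] :=
  cross_syzygies _ _ _ d_gt0 hf hred _ _ (generator_AR i) (generator_AR j).
have [|k kh] := koszul_span_unit _ _ _ d_gt0 hf hred _ _ _ hE.
  move=> k; apply: low_syzygy_span (koszul_homog _ _ _ hf k) _ ij big.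
  exact: koszul_AR.
exact: (cross_generators_not_unit _ _ _ _ m3 hE kh).
Qed.

End MinimalGenerators.

(** * Passage from generators to the sorted list of exponents *)

Theorem theorem2p4 (R : realType) (d : nat) (f : polyC3 R) (m : nat)
    (e : m.-tuple nat)
    (hd : (3 <= d)%N)
    (hf : f \is d.-homog)
    (hred : reduced_curve f)
    (hm : (3 <= m)%N)
    (he : syzygy_curve f e)
    (he1 : (1 <= nth 0 e 0)%N) :
  (d <= nth 0 e 0 + nth 0 e 1)%N /\
  (nth 0 e 0 <= nth 0 e 1)%N /\
  (nth 0 e 1 <= nth 0 e 2)%N /\
  (nth 0 e 2 <= d - 1)%N.
Proof.
have [esort [rho [hmin hrho]]] := he.
have d0 : (0 < d)%N by lia.
have mono i j : (i <= j)%N -> (j < m)%N -> (nth 0 e i <= nth 0 e j)%N.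
  move=> ij jm; apply: (sorted_leq_nth leq_trans leqnn) => //;
    by rewrite inE size_tuple; lia.
have m0 : (0 < m)%N by lia.
have m1 : (1 < m)%N by lia.
pose i0 := Ordinal m0; pose i1 := Ordinal m1.
have i01 : i0 != i1 by [].
split.
  rewrite -(tnth_nth _ _ i0) -(tnth_nth _ _ i1).
  apply: (min_exponents_sum _ _ _ _ _ d0 hf hred hmin _ hrho) => // k.
  by rewrite !(tnth_nth 0); apply: mono.
split; first by apply: mono.
split; first by apply: mono.
have [l [l0 l1 el]] :=
  third_exponent_bound _ _ _ _ _ d0 hf hred hmin _ hrho _ _ hm i01.
(* The index [l] differs from 0 and 1, so it is at least 2 and sortedness applies. *)
rewrite subn1; apply: leq_trans el; rewrite (tnth_nth 0); apply: mono => //.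
by case: l l0 l1 => [[|[|l]] lm].
Qed.
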